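(* Let $y\in\mathbb R_+^n$, $d\in\mathbb R_{++}^n$, and $M_d(y):=\{x\in\mathbb R^n\,|\,x\prec_d y\}$. Then there exists $z\in M_d(y)$ such that $x\prec z$ for all $x\in M_d(y)$, and such $z$ is unique up to permutation of its entries. More precisely, let $f:[0,\mathbf 1^Td]\to\mathbb R$, $f(c)=\min_{i=1,\ldots,n}\big(\mathbf 1^T(y-\frac{y_i}{d_i}d)_+ +\frac{y_i}{d_i}c\big)$, let $\sigma\in S_n$ satisfy $d_{\sigma(1)}\geq\cdots\geq d_{\sigma(n)}$, and let $z\in\mathbb R^n$ be the unique solution of $\sum_{i=1}^j z_{\sigma(i)}=f\big(\sum_{i=1}^j d_{\sigma(i)}\big)$, $j=1,\ldots,n$. Then $M_d(y)\subseteq\{x\in\mathbb R^n\,|\,x\prec z\}$, and moreover: (i) $z$ is an extreme point of $M_d(y)$; (ii) $\{x\,|\,x\prec_d z\}\subseteq\{x\,|\,x\prec z\}$; (iii) $\frac{z_{\sigma(1)}}{d_{\sigma(1)}}\geq\cdots\geq\frac{z_{\sigma(n)}}{d_{\sigma(n)}}$.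
   Context: $\mathbb R_+^n$ ($\mathbb R_{++}^n$) are vectors with nonnegative (strictly positive) entries, $\mathbf 1=(1,\ldots,1)^T$, $(\cdot)_+$ acts entrywise as $\max\{\cdot,0\}$, $S_n$ the symmetric group. Classical majorization: for $x,w\in\mathbb R^n$, $x\prec w$ means $\mathbf 1^Tx=\mathbf 1^Tw$ and $\sum_{i=1}^j x_i^\downarrow\leq\sum_{i=1}^j w_i^\downarrow$ for $j=1,\ldots,n-1$, where $x^\downarrow$ is $x$ rearranged decreasingly. A matrix $A$ is $d$-stochastic if it is entrywise nonnegative, $\mathbf 1^TA=\mathbf 1^T$ and $Ad=d$; $x\prec_d y$ means $x=Ay$ for some $d$-stochastic $A$. *)

(* Defs.v *)
From mathcomp Require Import all_boot all_order all_algebra all_fingroup.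
From mathcomp Require Import classical_sets reals.

Set Implicit Arguments.
Unset Strict Implicit.
Unset Printing Implicit Defensive.

Import Order.TTheory GRing.Theory Num.Theory.
Local Open Scope ring_scope.

(* Entries of column vectors are indexed by 'I_n = {0, ..., n-1}. *)

Definition decr (R : realType) (n : nat) (x : 'cV[R]_n) : 'cV[R]_n :=
  \col_(i < n) nth 0 (sort >=%R [seq x i 0 | i : 'I_n]) i.

Definition majorized (R : realType) (n : nat) (x w : 'cV[R]_n) : Prop :=
  \sum_i x i 0 = \sum_i w i 0 /\
  forall j : nat, (1 <= j < n)%N ->
    \sum_(i < n | (i < j)%N) decr x i 0 <= \sum_(i < n | (i < j)%N) decr w i 0.

Definition d_stochastic (R : realType) (n : nat) (d : 'cV[R]_n) (A : 'M[R]_n)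
    : Prop :=
  [/\ forall i j, 0 <= A i j,
      (const_mx 1 : 'rV[R]_n) *m A = const_mx 1
    & A *m d = d].

Definition d_majorized (R : realType) (n : nat) (d x y : 'cV[R]_n) : Prop :=
  exists A : 'M[R]_n, d_stochastic d A /\ x = A *m y.

Definition d_polytope (R : realType) (n : nat) (d y : 'cV[R]_n)
    : set 'cV[R]_n :=
  [set x | d_majorized d x y]%classic.

Definition extreme_point (R : realType) (V : lmodType R) (S : set V) (x : V)
    : Prop :=
  S x /\
  forall (a b : V) (t : R), S a -> S b -> 0 < t < 1 ->
    x = t *: a + (1 - t) *: b -> a = x /\ b = x.

Definition pos_part (R : realType) (n : nat) (x : 'cV[R]_n) : 'cV[R]_n :=
  map_mx (fun a => Num.max a 0) x.

Definition f_term (R : realType) (n : nat) (d y : 'cV[R]_n) (i : 'I_n) (c : R)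
    : R :=
  \sum_k pos_part (y - (y i 0 / d i 0) *: d) k 0 + y i 0 / d i 0 * c.

(* Only the values at arguments 0 <= c <= \sum_i d i 0 are meaningful here.
   The term at ord0 merely seeds the minimum, which ranges over a nonempty
   index set containing ord0. *)
Definition f_min (R : realType) (n : nat) (d y : 'cV[R]_n.+1) (c : R) : R :=
  \big[Num.min/f_term d y ord0 c]_(i < n.+1) f_term d y i c.

Definition is_greatest (R : realType) (n : nat) (S : set 'cV[R]_n)
    (z : 'cV[R]_n) : Prop :=
  S z /\ forall x, S x -> majorized x z.

Definition solves (R : realType) (n : nat) (d y : 'cV[R]_n.+1)
    (s : 'S_n.+1) (z : 'cV[R]_n.+1) : Prop :=
  forall j : 'I_n.+1,
    \sum_(i < n.+1 | (i <= j)%N) z (s i) 0 =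
    f_min d y (\sum_(i < n.+1 | (i <= j)%N) d (s i) 0).

(* Main.v *)
(** Order the ratios [y_k / d_k] decreasingly and lay the [d_k] end to end as
    cells of the segment [[0, sum d]].  Then [f] is the concave Lorenz curve
    whose slope on the cell of [k] is [y_k / d_k].  Laying the [d_k] end to end
    in the order [s] gives a second subdivision; moving from cell [q] to cell
    [p] the proportion [|J_p /\ I_q| / d_q] of their overlap is a d-stochastic
    matrix which sends [y] to [z].  Conversely, averaging
    [y - t d <= (y - t d)_+] shows that the entries in a set [P] of any
    [x] in [M_d(y)] sum to at most [f (d(P))], hence, as [f] is nondecreasing,
    to at most the sum of the first [#|P|] entries of [z]. *)

Require Import Defs.
From mathcomp Require Import all_boot all_order all_algebra all_fingroup.
From mathcomp Require Import classical_sets reals ring lra.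

Import Order.TTheory GRing.Theory Num.Theory.
Set Implicit Arguments.
Unset Strict Implicit.
Unset Printing Implicit Defensive.

Local Open Scope ring_scope.
Local Open Scope classical_set_scope.

(** * Partial sums, decreasing rearrangement and classical majorization *)

Definition psum {R : realType} {n : nat} (h : 'I_n -> R) (j : nat) : R :=
  \sum_(i < n | (i < j)%N) h i.

Lemma psum0 {R : realType} {n} (h : 'I_n -> R) : psum h 0 = 0.
Proof. by rewrite /psum big_pred0. Qed.

Lemma psumS {R : realType} {n} (h : 'I_n -> R) (j : 'I_n) :
  psum h j.+1 = psum h j + h j.
Proof.
rewrite /psum (bigD1 j) //= addrC; congr (_ + _).
by apply: eq_bigl => i; rewrite ltnS ltn_neqAle andbC.
Qed.

Lemma psum_all {R : realType} {n} (h : 'I_n -> R) j :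
  (n <= j)%N -> psum h j = \sum_i h i.
Proof.
by move=> le_nj; apply: eq_bigl => i; rewrite (leq_trans (ltn_ord i)).
Qed.

Lemma psum_telescope {R : realType} {n} (g : nat -> R) j : (j <= n)%N ->
  psum (fun i : 'I_n => g i.+1 - g i) j = g j - g 0%N.
Proof.
elim: j => [|j IHj] le_jn; first by rewrite psum0 subrr.
rewrite (psumS _ (Ordinal le_jn)) IHj 1?ltnW //=; ring.
Qed.

Lemma psum_homo {R : realType} {n} (h : 'I_n -> R) : (forall i, 0 <= h i) ->
  {homo psum h : i j / (i <= j)%N >-> i <= j}.
Proof.
move=> h0 i j le_ij; rewrite /psum [leLHS]big_mkcond [leRHS]big_mkcond /=.
apply: ler_sum => k _; case: ifP => [ki|_]; first by rewrite (leq_trans ki).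
by case: ifP.
Qed.

Lemma psum_inj {R : realType} {n} (h1 h2 : 'I_n -> R) :
  (forall j : 'I_n, psum h1 j.+1 = psum h2 j.+1) -> h1 =1 h2.
Proof.
move=> E; suff E' j : (j <= n)%N -> psum h1 j = psum h2 j.
  by move=> j; apply: (addrI (psum h1 j)); rewrite -psumS E psumS E' // ltnW.
by case: j => [|j] lt_jn; [rewrite !psum0 | exact: (E (Ordinal lt_jn))].
Qed.

(* Compares both sums after subtracting the threshold [h (s j)]: the right one
   becomes the sum of all positive parts. *)
Lemma psum_perm_le {R : realType} {n} (h : 'I_n -> R) (p s : 'S_n) j :
  (forall i k : 'I_n, (i <= k)%N -> h (s k) <= h (s i)) ->
  psum (fun i => h (p i)) j <= psum (fun i => h (s i)) j.
Proof.
move=> h_anti; case: (leqP n j) => [le_nj|lt_jn].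
  rewrite !psum_all // -(reindex_inj (@perm_inj _ p) (P := xpredT) (F := h)).
  by rewrite [leLHS](reindex_inj (@perm_inj _ s)).
pose t := h (s (Ordinal lt_jn)).
suff: \sum_(i < n | (i < j)%N) (h (p i) - t) <=
      \sum_(i < n | (i < j)%N) (h (s i) - t).
  by rewrite !sumrB lerD2r.
have -> : \sum_(i < n | (i < j)%N) (h (s i) - t) = \sum_i Num.max (h i - t) 0.
  rewrite big_mkcond [RHS](reindex_inj (@perm_inj _ s)) /=.
  apply: eq_bigr => i _.
  case: ltnP => [lt_ij|le_ji]; [rewrite max_l | rewrite max_r] => //.
    by rewrite subr_ge0 h_anti // ltnW.
  by rewrite subr_le0 h_anti.
rewrite [leRHS](reindex_inj (@perm_inj _ p)) big_mkcond /=.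
by apply: ler_sum => i _; case: ifP; rewrite le_max lexx ?orbT.
Qed.

(** Trades the sorted list behind [decr] for a sorting permutation, so that later arguments only
    reindex sums. *)
Lemma decr_perm {R : realType} {n} (x : 'cV[R]_n) :
  exists2 s : 'S_n, decr x = row_perm s x &
    forall i j : 'I_n, (i <= j)%N -> x (s j) 0 <= x (s i) 0.
Proof.
pose l := [seq x i 0 | i : 'I_n].
have szl : size (sort >=%R l) = n by rewrite size_sort size_map size_enum_ord.
have [s Es] : exists s : 'S_n, sort >=%R l =
    [tuple tnth [tuple x i 0 | i < n] (s i) | i < n].
  by apply/tuple_permP; rewrite perm_sort.
have nthE i : nth 0 (sort >=%R l) (nat_of_ord i) = x (s i) 0.
  by rewrite Es -tnth_nth !tnth_mktuple.
exists s; first by apply/colP => i; rewrite !mxE nthE.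
move=> i j le_ij; rewrite -!nthE.
have ge_tr : transitive (>=%R : rel R).
  by move=> a b c ab bc; exact: le_trans bc ab.
have ge_tot : total (>=%R : rel R) by move=> a b; exact: le_total.
have ge_refl : reflexive (>=%R : rel R) by move=> a; exact: lexx.
apply: (sorted_leq_nth ge_tr ge_refl 0 (sort_sorted ge_tot l)) => //.
  by rewrite inE szl.
by rewrite inE szl.
Qed.

Lemma psum_decr_ge {R : realType} {n} (x : 'cV[R]_n) (p : 'S_n) j :
  psum (fun i => x (p i) 0) j <= psum (fun i => decr x i 0) j.
Proof.
have [s -> x_anti] := decr_perm x.
rewrite /psum.
under [leRHS]eq_bigr do rewrite mxE.
exact: (psum_perm_le (h := fun i => x i 0)).
Qed.

(** Equal prefix sums give equal decreasing rearrangements. This is the source of uniqueness up to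
    permutation. *)
Lemma majorized_anti {R : realType} {n} (x w : 'cV[R]_n) :
  majorized x w -> majorized w x -> exists s : 'S_n, x = row_perm s w.
Proof.
move=> [sxw le_xw] [_ le_wx].
have [s Ex _] := decr_perm x; have [t Ew _] := decr_perm w.
have sum_decr (v : 'cV[R]_n) (p : 'S_n) : decr v = row_perm p v ->
    \sum_i decr v i 0 = \sum_i v i 0.
  by move=> ->; rewrite [RHS](reindex_inj (@perm_inj _ p));
     apply: eq_bigr => i _; rewrite mxE.
have Exw : decr x = decr w.
  apply/colP; apply: psum_inj => j.
  case: (ltnP j.+1 n) => [lt_jn|le_nj].
    by apply/eqP; rewrite eq_le le_xw ?le_wx.
  by rewrite !psum_all // (sum_decr _ _ Ex) (sum_decr _ _ Ew).
exists (s^-1 * t)%g; rewrite row_permM -Ew -Exw Ex -row_permM mulVg.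
by rewrite row_perm1.
Qed.

(** The quantity is the length of the overlap of [[u, v]] and [[w, x]]. *)
Lemma min_diff_ge0 {R : realType} (u v w x : R) : u <= v -> w <= x ->
  0 <= (Num.min v x - Num.min v w) - (Num.min u x - Num.min u w).
Proof.
move=> uv wx.
by case: (leP v x) => ?; case: (leP v w) => ?; case: (leP u x) => ?;
   case: (leP u w) => ?; lra.
Qed.

(** * The curve [f_min] as a minimum of affine functions with slopes [a i] *)

Section Lorenz.
Context (R : realType) (n : nat) (y d : 'cV[R]_n.+1).
Hypotheses (hy : forall i, 0 <= y i 0) (hd : forall i, 0 < d i 0).

Let a i := y i 0 / d i 0.

Lemma f_termE i c :
  f_term d y i c = \sum_k Num.max (y k 0 - a i * d k 0) 0 + a i * c.
Proof. by congr (_ + _); apply: eq_bigr => k _; rewrite !mxE. Qed.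

Lemma f_term_shift i b c : f_term d y i c = f_term d y i b + a i * (c - b).
Proof. by rewrite /f_term -/(a i); ring. Qed.

Lemma f_min_le i c : f_min d y c <= f_term d y i c.
Proof. exact: bigmin_le. Qed.

Lemma f_min_ex c : exists i, f_min d y c = f_term d y i c.
Proof.
rewrite /f_min; elim/big_ind: _ => [|u v [i ->] [j ->]|i _]; first by exists ord0.
  by rewrite minEle; case: ifP; [exists i | exists j].
by exists i.
Qed.

Lemma f_min_homo : {homo f_min d y : b c / b <= c}.
Proof.
move=> b c le_bc; have [i ->] := f_min_ex c.
apply: le_trans (f_min_le i b) _.
by rewrite (f_term_shift i b c) lerDl mulr_ge0 ?subr_ge0 // divr_ge0 // ltW.
Qed.

(** Concavity: the left secant has at least the slope of a term active at [p + u], the right one at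
    most the slope of a term active at [q]. *)
Lemma f_min_slope p u q v : 0 < u -> 0 < v -> p + u <= q ->
  (f_min d y (q + v) - f_min d y q) / v <= (f_min d y (p + u) - f_min d y p) / u.
Proof.
move=> u0 v0 le_pq.
have [i Ei] := f_min_ex (p + u).
(* If [p + u < q], comparing the terms active at these two points shows that the slope cannot
   increase. *)
have [j Ej le_ji] : exists2 j, f_min d y q = f_term d y j q & a j <= a i.
  move: le_pq; rewrite le_eqVlt => /predU1P[<-|lt_pq]; first by exists i.
  have [j Ej] := f_min_ex q; exists j => //.
  have := f_min_le j (p + u); have := f_min_le i q.
  rewrite Ei Ej (f_term_shift i (p + u) q) (f_term_shift j (p + u) q).
  move=> h1 h2; have : (a j - a i) * (q - (p + u)) <= 0 by nra.
  by rewrite pmulr_lle0 ?subr_gt0 // subr_le0.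
apply: (@le_trans _ _ (a j)); last apply: (le_trans le_ji).
  rewrite ler_pdivrMr // Ej; have := f_min_le j (q + v).
  by rewrite (f_term_shift j q (q + v)); lra.
rewrite ler_pdivlMr // Ei; have := f_min_le i p.
by rewrite (f_term_shift i p (p + u)); lra.
Qed.

Lemma sum_le_f_min (x : 'cV[R]_n.+1) (P : pred 'I_n.+1) :
  d_majorized d x y ->
  \sum_(i | P i) x i 0 <= f_min d y (\sum_(i | P i) d i 0).
Proof.
move=> [A [[A0 A1 Ad] ->]]; have [k ->] := f_min_ex (\sum_(i | P i) d i 0).
rewrite f_termE; set t := a k; set m := fun l => Num.max (y l 0 - t * d l 0) 0.
have colA l : \sum_i A i l = 1.
  move/rowP/(_ l): A1; rewrite !mxE => <-.
  by apply: eq_bigr => i _; rewrite mxE mul1r.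
rewrite -lerBlDr mulr_sumr -sumrB.
(* All [A i l * m l] are nonnegative, so the rows outside [P] may be added; the column sums 1 then
   eliminate [A]. *)
apply: (@le_trans _ _ (\sum_i \sum_l A i l * m l)).
  rewrite [leLHS]big_mkcond; apply: ler_sum => i _.
  have m0 l : 0 <= A i l * m l by rewrite mulr_ge0 // le_max lexx orbT.
  case: ifP => _; last exact: sumr_ge0.
  (* As [A] fixes [d], the threshold is averaged with the same weights as [y]. *)
  have -> : d i 0 = \sum_l A i l * d l 0 by rewrite -{1}Ad mxE.
  rewrite mxE mulr_sumr -sumrB; apply: ler_sum => l _.
  have -> : A i l * y l 0 - t * (A i l * d l 0) = A i l * (y l 0 - t * d l 0).
    by ring.
  by rewrite ler_wpM2l // le_max lexx.
rewrite exchange_big /=; apply: ler_sum => l _.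
by rewrite -mulr_suml colA mul1r.
Qed.

(** Weak duality: [m] spreads the mass [c] over cells of capacity [d k], and [(a k - a i) * m k] is
    at most the positive part of [y k 0 - a i * d k 0]. *)
Lemma le_f_min (m : 'I_n.+1 -> R) c : (forall k, 0 <= m k <= d k 0) ->
  \sum_k m k = c -> \sum_k a k * m k <= f_min d y c.
Proof.
move=> hm <-; have [i ->] := f_min_ex (\sum_k m k); rewrite f_termE.
rewrite mulr_sumr -big_split; apply: ler_sum => k _ /=.
have /andP[m0 md] := hm k.
have -> : y k 0 = a k * d k 0 by rewrite /a divfK ?gt_eqF.
rewrite -mulrBl -lerBlDr -mulrBl; have d0 := hd k; case: (leP (a i) (a k)) => h.
  by rewrite le_max ler_wpM2l ?subr_ge0.
by rewrite le_max [X in _ || X]mulr_le0_ge0 ?orbT // subr_le0 ltW.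
Qed.

(** Complementary slackness: filling the cells of slope above [a i] and emptying those below makes
    the duality bound of the term [i] tight. *)
Lemma eq_f_min (m : 'I_n.+1 -> R) c i : (forall k, 0 <= m k <= d k 0) ->
  (forall k, a i < a k -> m k = d k 0) -> (forall k, a k < a i -> m k = 0) ->
  \sum_k m k = c -> f_min d y c = \sum_k a k * m k.
Proof.
move=> hm full empty mc; apply/eqP; rewrite eq_le le_f_min // andbT.
apply: le_trans (f_min_le i c) _; rewrite f_termE -mc.
rewrite mulr_sumr -big_split; apply: ler_sum => k _ /=.
have -> : y k 0 = a k * d k 0 by rewrite /a divfK ?gt_eqF.
rewrite -lerBrDr -!mulrBl; have d0 := hd k; case: (ltgtP (a i) (a k)) => h.
- by rewrite full // max_l // mulr_ge0 // ?subr_ge0 ltW.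
- by rewrite empty // mulr0 max_r // mulr_le0_ge0 ?subr_le0 // ltW.
- by rewrite h subrr !mul0r maxxx.
Qed.

(** * Two subdivisions of [[0, sum d]], with cell ends [S] and [T] *)

Variables s t : 'S_n.+1.
Hypothesis t_anti : forall i j : 'I_n.+1, (i <= j)%N -> a (t j) <= a (t i).

Let S := psum (fun i => d (s i) 0).
Let T := psum (fun i => d (t i) 0).

Let S_le : {homo S : i j / (i <= j)%N >-> i <= j}.
Proof. by apply: psum_homo => i; exact: ltW. Qed.

Let T_le : {homo T : i j / (i <= j)%N >-> i <= j}.
Proof. by apply: psum_homo => i; exact: ltW. Qed.

Let S_n : S n.+1 = \sum_i d i 0.
Proof. by rewrite /S psum_all // [RHS](reindex_inj (@perm_inj _ s)). Qed.

Let T_n : T n.+1 = \sum_i d i 0.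
Proof. by rewrite /T psum_all // [RHS](reindex_inj (@perm_inj _ t)). Qed.

Let S_itv j : (j <= n.+1)%N -> 0 <= S j <= \sum_i d i 0.
Proof.
move=> jn; rewrite -[X in X <= _](psum0 (fun i => d (s i) 0)).
by rewrite -S_n !S_le.
Qed.

(* Length of [[0, c]] inside the cell [[T k, T k.+1]], for [0 <= c]. *)
Definition fill c (k : nat) : R := Num.min c (T k.+1) - Num.min c (T k).

Lemma fill_itv c (k : 'I_n.+1) : 0 <= fill c k <= d (t k) 0.
Proof.
have := psumS (fun i => d (t i) 0) k; rewrite -/T /fill => ->; have := hd (t k).
by case: (leP c (T k)) => ?; case: (leP c (T k + d (t k) 0)) => ?; lra.
Qed.

Lemma sum_fill c : 0 <= c <= \sum_i d i 0 -> \sum_(k < n.+1) fill c k = c.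
Proof.
move=> /andP[c0 cD]; rewrite -(psum_all _ (leqnn n.+1)).
rewrite (psum_telescope (fun k => Num.min c (T k))) // T_n min_l //.
by rewrite /T psum0 min_r // subr0.
Qed.

Lemma fill0 (k : 'I_n.+1) : fill 0 k = 0.
Proof.
have T0 j : 0 <= T j by rewrite -(psum0 (fun i => d (t i) 0)) T_le.
by rewrite /fill !min_l // subrr.
Qed.

Lemma fill_full (k : 'I_n.+1) : fill (\sum_i d i 0) k = d (t k) 0.
Proof.
rewrite /fill -T_n !min_r ?T_le // 1?ltnW //.
by rewrite /T psumS addrAC subrr add0r.
Qed.

(** Greedy filling in decreasing order of the ratios is optimal. *)
Lemma f_min_fill c : 0 <= c <= \sum_i d i 0 ->
  f_min d y c = \sum_k a k * fill c (t^-1%g k).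
Proof.
move=> c_itv; have /andP[c0 cD] := c_itv.
have cT : c <= T (@ord_max n).+1 by rewrite T_n.
(* The threshold [i] is the first cell whose right end reaches [c], so [c] lies in it: earlier cells
   are full, later ones empty. *)
case: (arg_minnP (P := fun k : 'I_n.+1 => c <= T k.+1) val cT) => i cTi i_min.
have Ti : T i <= c.
  case: i i_min {cTi} => -[|j] lt_jn /= i_min; first by rewrite /T psum0.
  rewrite leNgt; apply/negP => /ltW /(i_min (Ordinal (ltnW lt_jn))) /=.
  by rewrite ltnn.
apply: (@eq_f_min _ _ (t i)).
- by move=> k; have := fill_itv c (t^-1%g k); rewrite permKV.
- move=> k; rewrite -{1 3}(permKV t k); move: (t^-1%g k) => {}k lt_a.
  have lt_ki : (k < i)%N.
    by rewrite ltnNge; apply: contraL lt_a => /t_anti; rewrite leNgt.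
  have := T_le lt_ki; rewrite /fill => Tk; rewrite !min_r; first last.
  + exact: le_trans Ti.
  + by apply: le_trans Ti; apply: T_le; exact: ltnW.
  by rewrite /T psumS addrAC subrr add0r.
- move=> k; rewrite -{1}(permKV t k); move: (t^-1%g k) => {}k lt_a.
  have lt_ik : (i < k)%N.
    by rewrite ltnNge; apply: contraL lt_a => /t_anti; rewrite leNgt.
  rewrite /fill !min_l ?subrr //; apply: (le_trans cTi); apply: T_le => //.
  exact: ltnW.
- rewrite -[RHS](sum_fill c_itv) [LHS](reindex_inj (@perm_inj _ t)).
  by apply: eq_bigr => k _; rewrite permK.
Qed.

Lemma f_min0 : f_min d y 0 = 0.
Proof.
have D0 : 0 <= \sum_i d i 0 by rewrite sumr_ge0 // => i _; exact: ltW.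
by rewrite f_min_fill ?lexx // big1 // => k _; rewrite fill0 mulr0.
Qed.

(* The numerator is the length of the overlap of the cell of [p] in the order [s]
   with the cell of [q] in the order [t]. *)
Definition lorenz_mx : 'M[R]_n.+1 := \matrix_(p, q)
  ((fill (S (s^-1%g p).+1) (t^-1%g q) - fill (S (s^-1%g p)) (t^-1%g q)) / d q 0).

(** The cells of [s] exhaust the cell of [q], which gives the column sums; the cells of [t] exhaust
    the cell of [p], which gives the fixed vector [d]. *)
Lemma lorenz_mx_stochastic : d_stochastic d lorenz_mx.
Proof.
split.
- move=> p q; rewrite mxE divr_ge0 ?(ltW (hd _)) // /fill.
  by apply: min_diff_ge0; [exact: S_le | exact: T_le].
- apply/rowP => q; rewrite !mxE.
  rewrite (reindex_inj (@perm_inj _ s)) /=.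
  under eq_bigr do rewrite !mxE mul1r permK.
  rewrite -mulr_suml -(psum_all _ (leqnn n.+1)).
  rewrite (psum_telescope (fun j => fill (S j) (t^-1%g q))) // S_n.
  by rewrite /S psum0 fill0 fill_full permKV subr0 divff ?gt_eqF.
- apply/colP => p; rewrite !mxE -{2}(permKV s p); set j := s^-1%g p.
  under eq_bigr do rewrite !mxE -/j divfK ?gt_eqF //.
  rewrite (reindex_inj (@perm_inj _ t)) /=.
  under eq_bigr do rewrite permK.
  rewrite sumrB !sum_fill ?S_itv // 1?ltnW //.
  by rewrite /S psumS addrAC subrr add0r.
Qed.

(** Division by [d q] turns [y q] into the slope [a q], so each entry of the image is the increment
    of [f] over one cell of [s]; these telescope from [f 0 = 0]. *)
Lemma lorenz_solves : solves d y s (lorenz_mx *m y).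
Proof.
move=> j; pose g i := f_min d y (S i).
have g0 : g 0%N = 0 by rewrite /g /S psum0 f_min0.
transitivity (psum (fun i : 'I_n.+1 => g i.+1 - g i) j.+1); last first.
  by rewrite psum_telescope // g0 subr0.
apply: eq_bigr => i _; rewrite /g !f_min_fill ?S_itv // 1?ltnW //.
rewrite mxE -sumrB; apply: eq_bigr => q _; rewrite mxE permK /a.
by field; rewrite gt_eqF.
Qed.

End Lorenz.

(** * Sorting orders, uniqueness of solutions and [d]-majorization *)

Lemma sorting_perm {R : realType} {n} (h : 'I_n -> R) :
  exists s : 'S_n, forall i j : 'I_n, (i <= j)%N -> h (s j) <= h (s i).
Proof.
have [s _ s_anti] := decr_perm (\col_i h i).
by exists s => i j /s_anti; rewrite !mxE.
Qed.

Lemma solves_uniq {R : realType} {n} (d y : 'cV[R]_n.+1) s z w :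
  solves d y s z -> solves d y s w -> z = w.
Proof.
move=> hz hw; apply/colP => i; rewrite -(permKV s i); move: (s^-1%g i) => {}i.
suff E : (fun i => z (s i) 0) =1 (fun i => w (s i) 0) by exact: E.
(* The sums over [i <= j] in [solves] are [psum] at [j.+1] by conversion. *)
by apply: psum_inj => j; rewrite [LHS]hz [RHS]hw.
Qed.

Lemma d_stochastic_mul {R : realType} {n} (d : 'cV[R]_n) A B :
  d_stochastic d A -> d_stochastic d B -> d_stochastic d (A *m B).
Proof.
move=> [A0 A1 Ad] [B0 B1 Bd]; split; last by rewrite -mulmxA Bd.
  by move=> i j; rewrite mxE sumr_ge0 // => k _; rewrite mulr_ge0.
by rewrite mulmxA A1.
Qed.

Lemma d_majorized_trans {R : realType} {n} (d x y z : 'cV[R]_n) :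
  d_majorized d x y -> d_majorized d y z -> d_majorized d x z.
Proof.
move=> [A [hA ->]] [B [hB ->]]; exists (A *m B); split; last by rewrite mulmxA.
exact: d_stochastic_mul.
Qed.

Lemma d_majorized_sum {R : realType} {n} (d x y : 'cV[R]_n) :
  d_majorized d x y -> \sum_i x i 0 = \sum_i y i 0.
Proof.
move=> [A [[_ A1 _] ->]].
have := congr1 (fun B => (B *m y) 0 0) A1; rewrite -mulmxA !mxE.
by under eq_bigr do rewrite mxE mul1r; under [RHS]eq_bigr do rewrite mxE mul1r.
Qed.

Theorem theorem4p19 (R : realType) (n : nat) (y d : 'cV[R]_n.+1)
    (hy : forall i, 0 <= y i 0) (hd : forall i, 0 < d i 0) :
  (exists2 z : 'cV[R]_n.+1, is_greatest (d_polytope d y) z &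
     forall z' : 'cV[R]_n.+1, is_greatest (d_polytope d y) z' ->
       exists s : 'S_n.+1, z' = row_perm s z) /\
  (forall s : 'S_n.+1,
     (forall i j : 'I_n.+1, (i <= j)%N -> d (s j) 0 <= d (s i) 0) ->
     (exists! z : 'cV[R]_n.+1, solves d y s z) /\
     (forall z : 'cV[R]_n.+1, solves d y s z ->
        [/\ d_polytope d y `<=` [set x | majorized x z],
            extreme_point (d_polytope d y) z,
            d_polytope d z `<=` [set x | majorized x z]
          & forall i j : 'I_n.+1, (i <= j)%N ->
              z (s j) 0 / d (s j) 0 <= z (s i) 0 / d (s i) 0])).
Proof.
have [t t_anti] := sorting_perm (fun i => y i 0 / d i 0).
have main (s : 'S_n.+1) : (forall i j : 'I_n.+1, (i <= j)%N -> d (s j) 0 <= d (s i) 0) ->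
    exists z, [/\ solves d y s z, d_majorized d z y &
                  forall x, d_majorized d x y -> majorized x z].
  move=> s_anti; exists (lorenz_mx d s t *m y).
  have z_sol := lorenz_solves hd s t_anti.
  have z_maj : d_majorized d (lorenz_mx d s t *m y) y.
    by exists (lorenz_mx d s t); split=> //; exact: lorenz_mx_stochastic.
  split=> // x x_maj; split.
    by rewrite (d_majorized_sum x_maj) (d_majorized_sum z_maj).
  move=> [//|j] /andP[_ lt_jn].
  (* The decreasing prefix sums of [z] dominate those in the order [s], where they are values of
     [f]. *)
  apply: le_trans (psum_decr_ge _ s j.+1).
  rewrite [leRHS](z_sol (Ordinal (ltnW lt_jn))).
  have [p -> _] := decr_perm x.
  under eq_bigr do rewrite mxE.
  have -> : \sum_(i < n.+1 | (i < j.+1)%N) x (p i) 0 =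
      \sum_(i | ((p^-1)%g i < j.+1)%N) x i 0.
    rewrite [RHS](reindex_inj (@perm_inj _ p)).
    by apply: eq_bigl => i; rewrite permK.
  apply: (le_trans (sum_le_f_min _ x_maj)); apply: f_min_homo => //.
  rewrite (reindex_inj (@perm_inj _ p)) /=.
  under eq_bigl do rewrite permK.
  exact: (psum_perm_le (h := fun i => d i 0)).
split.
  have [s s_anti] := sorting_perm (fun i => d i 0).
  have [z [_ z_maj z_top]] := main s s_anti.
  exists z; first by split.
  move=> z' [z'_maj z'_top]; apply: majorized_anti; first exact: z_top.
  exact: z'_top.
move=> s s_anti; have [z [z_sol z_maj z_top]] := main s s_anti.
split; first by exists z; split=> // w; exact: solves_uniq.
move=> _ /(solves_uniq z_sol) <-; split=> //.
(* Along [s], no prefix sum of a point of the polytope exceeds that of [z]. A combination with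
   positive weights that attains this bound forces both [u] and [v] to attain it. *)
- split=> // u v r u_maj v_maj /andP[r0 r1] zE.
  have le_z x : d_majorized d x y -> forall j : 'I_n.+1,
      psum (fun i => x (s i) 0) j.+1 <= psum (fun i => z (s i) 0) j.+1.
    move=> x_maj j; rewrite [leRHS]z_sol.
    have := sum_le_f_min (fun i => ((s^-1)%g i <= j)%N) x_maj.
    rewrite (reindex_inj (@perm_inj _ s)).
    rewrite [X in f_min _ _ X](reindex_inj (@perm_inj _ s)).
    under eq_bigl do rewrite permK.
    by under [X in f_min _ _ X]eq_bigl do rewrite permK.
  have comb j : psum (fun i => z (s i) 0) j =
      r * psum (fun i => u (s i) 0) j + (1 - r) * psum (fun i => v (s i) 0) j.
    rewrite /psum !mulr_sumr -big_split; apply: eq_bigr => i _.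
    by rewrite zE !mxE.
  have eq_z (x : 'cV[R]_n.+1) : (forall j : 'I_n.+1,
      psum (fun i => x (s i) 0) j.+1 = psum (fun i => z (s i) 0) j.+1) -> x = z.
    move=> E; suff x_sol : solves d y s x by exact: solves_uniq z_sol.
    by move=> j; rewrite [LHS]E [LHS]z_sol.
  by split; apply: eq_z => j; have := le_z _ u_maj j; have := le_z _ v_maj j;
     have := comb j.+1; nra.
- by move=> x x_maj; apply: z_top; exact: d_majorized_trans z_maj.
- move=> i j; rewrite leq_eqVlt => /predU1P[/val_inj -> //|lt_ij].
  (* Each ratio is the slope of [f] over one cell of [s], so concavity orders the ratios. *)
  have zE k : z (s k) 0 = f_min d y (psum (fun i => d (s i) 0) k + d (s k) 0) -
      f_min d y (psum (fun i => d (s i) 0) k).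
    have psum_z m : (m <= n.+1)%N -> psum (fun i => z (s i) 0) m =
        f_min d y (psum (fun i => d (s i) 0) m).
      case: m => [_|m lt_mn]; first by rewrite !psum0 (f_min0 hd t_anti).
      exact: (z_sol (Ordinal lt_mn)).
    rewrite -psumS -!psum_z // 1?ltnW // psumS; ring.
  rewrite !zE; apply: f_min_slope => //.
  rewrite -psumS; apply: psum_homo => // k; exact: ltW.
Qed.
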